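(* If $n>1$ is an odd integer such that the angle $2\pi/n$ can be constructed, then there exists a countable dense subset of the unit circle $S^1$ consisting of non-$n$-sectable angles.
   Context: Let $S\subseteq\mathbb{R}^2$ contain $(0,0)$ and $(1,0)$. A point is constructible over $S$ if it can be obtained from points of $S$ by a finite sequence of straightedge-and-compass steps: (1) given two distinct points already available, one may draw the line through them, or the circle centered at one of them and passing through the other; (2) given two lines, two circles, or a line and a circle already drawn, one may add their intersection points. $C(S)$ denotes the set of all points constructible over $S$. An angle is given by its radian measure $\alpha\in\mathbb{R}$ and is identified with the point $(\cos\alpha,\sin\alpha)\in S^1$. The angle $\alpha$ is constructible if $(\cos\alpha,\sin\alpha)\in C(\{(0,0),(1,0)\})$. The angle $\alpha$ is $n$-sectable if $(\cos(\alpha/n),\sin(\alpha/n))\in C(\{(0,0),(1,0),(\cos\alpha,\sin\alpha)\})$, and non-$n$-sectable otherwise; when $2\pi/n$ is constructible this depends only on $\alpha$ modulo $2\pi$. *)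

(* Defs.v *)
From HB Require Import structures.
From mathcomp Require Import all_boot all_order all_algebra.
From mathcomp Require Import all_classical all_reals all_analysis.
Set Implicit Arguments.
Unset Strict Implicit.
Unset Printing Implicit Defensive.
Import Order.TTheory GRing.Theory Num.Theory.
Import numFieldNormedType.Exports.
Local Open Scope classical_set_scope.
Local Open Scope ring_scope.

Definition line (R : realType) (p q : R * R) : set (R * R) :=
  [set x | exists t : R,
     x = (p.1 + t * (q.1 - p.1), p.2 + t * (q.2 - p.2))].

(* The Euclidean distance is spelled out because the library norm on [R * R] *)
(* is the sup norm.                                                          *)
Definition circle (R : realType) (c p : R * R) : set (R * R) :=
  [set x | (x.1 - c.1) ^+ 2 + (x.2 - c.2) ^+ 2
         = (p.1 - c.1) ^+ 2 + (p.2 - c.2) ^+ 2].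

(* [constructible S] is C(S). The requirement [A <> B] in [constr_meet] says *)
(* that the two curves are distinct as point sets; without it every point of *)
(* a drawn curve would be constructible.                                     *)
Inductive constructible (R : realType) (S : set (R * R)) : R * R -> Prop :=
| constr_base (p : R * R) : S p -> constructible S p
| constr_meet (A B : set (R * R)) (p : R * R) :
    drawn S A -> drawn S B -> A <> B -> A p -> B p -> constructible S p
with drawn (R : realType) (S : set (R * R)) : set (R * R) -> Prop :=
| drawn_line (p q : R * R) :
    constructible S p -> constructible S q -> p <> q -> drawn S (line p q)
| drawn_circle (c p : R * R) :
    constructible S c -> constructible S p -> c <> p -> drawn S (circle c p).

Definition unit_circle (R : realType) : set (R * R) :=
  [set p | p.1 ^+ 2 + p.2 ^+ 2 = 1].

Definition angle_point (R : realType) (a : R) : R * R := (cos a, sin a).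

Definition constructible_angle (R : realType) (a : R) : Prop :=
  constructible [set (0, 0); (1, 0)] (angle_point a).

Definition sectable (R : realType) (n : nat) (a : R) : Prop :=
  constructible [set (0, 0); (1, 0); angle_point a] (angle_point (a / n%:R)).

(* Main.v *)
Require Import Defs.
From HB Require Import structures.
From mathcomp Require Import all_boot all_order all_algebra.
From mathcomp Require Import all_classical all_reals all_analysis.
From mathcomp Require Import ring lra complex.
Set Implicit Arguments.
Unset Strict Implicit.
Unset Printing Implicit Defensive.
Import Order.TTheory GRing.Theory Num.Theory.
Import numFieldNormedType.Exports.
Local Open Scope classical_set_scope.
Local Open Scope ring_scope.

(** If K is a field, s ^+ 2 is in K but s is not, and an element c of K has an
    n-th root z in K(s) with n = 2m + 1, then the norm N of z satisfies
    N ^+ n = c ^+ 2, so c / N ^+ m is an n-th root of c in K. Hence, by Zorn's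
    lemma, any c in Q(i) without n-th root in Q(i) has no n-th root in some
    extension K of Q(i) closed under square roots. The coordinates of the points
    constructible from 0, 1 and c lie in K, so if c = exp(i a) then
    exp(i a / n), an n-th root of c, is not constructible. The dense family of
    such c consists of the products of (3 + 4i)/5, which has no n-th root in
    Q(i) by infinite descent modulo 5, with the n-th powers of the rational
    points exp(2 i atan q) of the circle. *)

(** * Subfields and quadratic extensions *)

(** A predicate on subsets of a fixed field, so that Zorn's lemma applies to inclusion. Division by
    0 yields 0, hence no side condition on [y]. *)
Definition subfield (F : fieldType) (K : set F) : Prop :=
  [/\ K 1, (forall x y, K x -> K y -> K (x - y))
    & (forall x y, K x -> K y -> K (x / y))].

Section Subfield.
Variables (F : fieldType) (K : set F).
Hypothesis hK : subfield K.

Lemma subfield1 : K 1. Proof. by case: hK. Qed.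

Lemma subfieldB x y : K x -> K y -> K (x - y).
Proof. by case: hK => _ + _; apply. Qed.

Lemma subfield_div x y : K x -> K y -> K (x / y).
Proof. by case: hK => _ _; apply. Qed.

Lemma subfield0 : K 0.
Proof. by rewrite -(subrr 1); apply: subfieldB; apply: subfield1. Qed.

Lemma subfieldN x : K x -> K (- x).
Proof. by move=> Kx; rewrite -sub0r; apply: subfieldB => //; exact: subfield0. Qed.

Lemma subfieldD x y : K x -> K y -> K (x + y).
Proof. by move=> Kx Ky; rewrite -(opprK y); apply: subfieldB => //; exact: subfieldN. Qed.

Lemma subfieldV x : K x -> K x^-1.
Proof. by move=> Kx; rewrite -div1r; apply: subfield_div => //; exact: subfield1. Qed.

Lemma subfieldM x y : K x -> K y -> K (x * y).
Proof. by move=> Kx Ky; rewrite -(invrK y); apply: subfield_div => //; exact: subfieldV. Qed.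

Lemma subfieldX x n : K x -> K (x ^+ n).
Proof.
move=> Kx; elim: n => [|n IH]; first by rewrite expr0; exact: subfield1.
by rewrite exprS; apply: subfieldM.
Qed.

Lemma subfield_nat n : K n%:R.
Proof.
elim: n => [|n IH]; first exact: subfield0.
by rewrite -natr1; apply: subfieldD => //; exact: subfield1.
Qed.

End Subfield.

Definition adjoin_sqrt (F : fieldType) (K : set F) (s : F) : set F :=
  [set x | exists a b, [/\ K a, K b & x = a + b * s]].

Section AdjoinSqrt.
Variables (F : fieldType) (K : set F) (s : F).
Hypotheses (hK : subfield K) (Ks2 : K (s ^+ 2)) (Ks : ~ K s).

Lemma sub_adjoin_sqrt : K `<=` adjoin_sqrt K s.
Proof. by move=> x Kx; exists x, 0; split; rewrite ?mul0r ?addr0//; exact: subfield0. Qed.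

Lemma adjoin_sqrt_gen : adjoin_sqrt K s s.
Proof. by exists 0, 1; rewrite mul1r add0r; split=> //; [exact: subfield0|exact: subfield1]. Qed.

(** Otherwise [s] could be solved for in [K]. *)
Lemma adjoin_sqrt_coef0 a b : K a -> K b -> K (a + b * s) -> b = 0.
Proof.
move=> Ka Kb Kab; apply/eqP/negPn/negP => b0; apply: Ks.
have -> : s = (a + b * s - a) / b by field.
by apply: subfield_div => //; apply: subfieldB.
Qed.

(** The norm is the product of the conjugates [a + b * s] and [a - b * s]; if the second one
    vanishes, then [b = 0] and the two coincide. *)
Lemma adjoin_sqrt_norm0 a b : K a -> K b -> a ^+ 2 - b ^+ 2 * s ^+ 2 = 0 ->
  a + b * s = 0.
Proof.
move=> Ka Kb.
have -> : a ^+ 2 - b ^+ 2 * s ^+ 2 = (a + b * s) * (a + (- b) * s) by ring.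
move/eqP; rewrite mulf_eq0 => /orP[/eqP//|/eqP h].
have /eqP : - b = 0.
  by apply: (adjoin_sqrt_coef0 Ka (subfieldN hK Kb)); rewrite h; exact: subfield0.
by rewrite oppr_eq0 => /eqP b0; move: h; rewrite b0 oppr0.
Qed.

Lemma adjoin_sqrt_subfield : subfield (adjoin_sqrt K s).
Proof.
have mulP x y : adjoin_sqrt K s x -> adjoin_sqrt K s y -> adjoin_sqrt K s (x * y).
  move=> [a [b [Ka Kb ->]]] [a' [b' [Ka' Kb' ->]]].
  exists (a * a' + b * b' * s ^+ 2), (a * b' + b * a'); split; last by ring.
  - by apply: subfieldD => //; do !apply: subfieldM => //.
  - by apply: subfieldD => //; do !apply: subfieldM => //.
split.
- exact: sub_adjoin_sqrt (subfield1 hK).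
- move=> _ _ [a [b [Ka Kb ->]]] [a' [b' [Ka' Kb' ->]]].
  by exists (a - a'), (b - b'); split; [exact: subfieldB|exact: subfieldB|ring].
- move=> x y Kx [a [b [Ka Kb ->]]]; apply: mulP => //.
  have [N0|N0] := eqVneq (a ^+ 2 - b ^+ 2 * s ^+ 2) 0.
    rewrite (adjoin_sqrt_norm0 Ka Kb N0) invr0.
    exact: sub_adjoin_sqrt (subfield0 hK).
  have KN : K (a ^+ 2 - b ^+ 2 * s ^+ 2).
    by apply: subfieldB; rewrite ?subfieldX//; apply: subfieldM => //; exact: subfieldX.
  (* The inverse is the conjugate divided by the norm. *)
  exists (a / (a ^+ 2 - b ^+ 2 * s ^+ 2)), (- b / (a ^+ 2 - b ^+ 2 * s ^+ 2)).
  split; [exact: subfield_div | by apply: subfield_div => //; exact: subfieldN |].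
  have ab0 : a + b * s != 0.
    by apply: contraNneq N0 => h; apply/eqP; rewrite -exprMn subr_sqr h mulr0.
  by field; rewrite exprMn N0 ab0.
Qed.

(** Conjugation is multiplicative, so the same [A] and [B] serve both powers. *)
Lemma adjoin_sqrt_exp a b n : K a -> K b -> exists A B, [/\ K A, K B,
  (a + b * s) ^+ n = A + B * s & (a - b * s) ^+ n = A - B * s].
Proof.
move=> Ka Kb; elim: n => [|n [A [B [KA KB IH1 IH2]]]].
  exists 1, 0; split; rewrite ?expr0 ?mul0r ?addr0 ?subr0//.
  - exact: subfield1.
  - exact: subfield0.
exists (a * A + b * B * s ^+ 2), (a * B + b * A); split.
- by apply: subfieldD => //; do !apply: subfieldM => //.
- by apply: subfieldD => //; do !apply: subfieldM => //.
- by rewrite exprS IH1; ring.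
- by rewrite exprS IH2; ring.
Qed.

Lemma adjoin_sqrt_odd_root n c : odd n -> K c ->
  (exists2 z, adjoin_sqrt K s z & z ^+ n = c) ->
  exists2 w, K w & w ^+ n = c.
Proof.
move=> nodd Kc [z [a [b [Ka Kb ->]]] zn].
have n0 : n != 0%N by case: n nodd {zn}.
have [c0|c0] := eqVneq c 0.
  by exists 0; [exact: subfield0|rewrite c0 expr0n (negbTE n0)].
have [A [B [KA KB e1 e2]]] := adjoin_sqrt_exp n Ka Kb.
(* Since [z ^+ n = c] lies in [K], its [s]-part vanishes, and the conjugate of [z] is an n-th root
   of [c] as well. *)
have B0 : B = 0 by apply: (adjoin_sqrt_coef0 KA KB); rewrite -e1 zn.
move: e1 e2; rewrite B0 mul0r addr0 subr0 zn => <- zn'.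
set N := a ^+ 2 - b ^+ 2 * s ^+ 2.
have NE : N ^+ n = c ^+ 2.
  have -> : N = (a + b * s) * (a - b * s) by rewrite /N; ring.
  by rewrite exprMn zn zn' expr2.
exists (c / N ^+ n./2).
  apply: subfield_div => //; apply: subfieldX => //.
  by apply: subfieldB; rewrite ?subfieldX//; apply: subfieldM => //; exact: subfieldX.
rewrite exprMn exprVn -exprM mulnC exprM NE -exprM mul2n.
rewrite -{1}(odd_double_half n) nodd exprD expr1 mulfK//.
by rewrite expf_neq0.
Qed.

End AdjoinSqrt.

(** * A maximal extension without n-th root *)

Lemma subfield_bigcup (F : fieldType) (G : set (set F)) : G !=set0 ->
  (forall K, G K -> subfield K) -> total_on G subset ->
  subfield (\bigcup_(K in G) K).
Proof.
move=> [K0 GK0] Gsub Gtot.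
have common x y : (\bigcup_(K in G) K) x -> (\bigcup_(K in G) K) y ->
    exists K, [/\ G K, K x & K y].
  move=> [K GK Kx] [L GL Ly]; have [KL|LK] := Gtot _ _ GK GL.
  - by exists L; split=> //; exact: KL.
  - by exists K; split=> //; exact: LK.
split.
- by exists K0 => //; exact: subfield1 (Gsub _ GK0).
- move=> x y /common h /h [K [GK Kx Ky]].
  by exists K => //; exact: subfieldB (Gsub _ GK) _ _ Kx Ky.
- move=> x y /common h /h [K [GK Kx Ky]].
  by exists K => //; exact: subfield_div (Gsub _ GK) _ _ Kx Ky.
Qed.

(** Take [K] maximal among the subfields containing [K0] without n-th root of [c]. If [s ^+ 2] were
    in [K] but not [s], then [adjoin_sqrt K s] would be a larger such subfield. *)
Lemma sqrt_closed_no_odd_root (F : fieldType) (K0 : set F) (n : nat) (c : F) :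
  odd n -> subfield K0 -> K0 c -> (forall z, K0 z -> z ^+ n <> c) ->
  exists K : set F, [/\ K0 `<=` K, subfield K, (forall s, K (s ^+ 2) -> K s)
    & forall z, K z -> z ^+ n <> c].
Proof.
move=> nodd sK0 K0c K0n.
pose good (K : set F) := [/\ K0 `<=` K, subfield K & forall z, K z -> z ^+ n <> c].
(* The empty set is allowed because Zorn_bigcup includes the empty chain. *)
pose P (K : set F) := K = set0 \/ good K.
have [G GP Gtot|K [PK Kmax]] := @Zorn_bigcup F P.
  have [[L [GL Lgood]]|nogood] := pselect (exists L, G L /\ good L); last first.
    left; apply/seteqP; split=> // x [L GL Lx].
    have [L0|Lgood] := GP _ GL; first by rewrite L0 in Lx.
    by case: nogood; exists L.
  (* Discarding the empty members of the chain leaves its union unchanged. *)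
  right; pose G' := [set K | G K /\ good K].
  have -> : \bigcup_(K in G) K = \bigcup_(K in G') K.
    apply/seteqP; split=> x [M GM Mx]; last by case: GM => GM _; exists M.
    have [M0|Mgood] := GP _ GM; first by rewrite M0 in Mx.
    by exists M.
  split.
  - by move=> x K0x; exists L => //; case: Lgood => + _ _; apply.
  - apply: subfield_bigcup; first by exists L.
      by move=> M [_ []].
    by move=> M M' [GM _] [GM' _]; exact: Gtot.
  - by move=> z [M [_ [_ _ Mn]] Mz]; exact: Mn.
have {PK} [K00|[K0K sK Kn]] := PK.
  (* The empty set is not maximal, being properly contained in [K0]. *)
  exfalso; apply: (Kmax K0); last by right; split.
  rewrite K00; split=> // /(_ _ (subfield1 sK0)); exact.
exists K; split=> // s Ks2; apply: contrapT => Ks.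
apply: (Kmax (adjoin_sqrt K s)).
  split; first exact: sub_adjoin_sqrt.
  by move=> /(_ s (adjoin_sqrt_gen s sK)).
right; split.
- by apply: subset_trans K0K _; exact: sub_adjoin_sqrt.
- exact: adjoin_sqrt_subfield.
- move=> z Kz zn.
  have [w Kw wn] := adjoin_sqrt_odd_root sK Ks2 Ks nodd (K0K _ K0c)
    (ex_intro2 _ _ z Kz zn).
  exact: Kn Kw wn.
Qed.

(** * Lines and circles over a field closed under square roots *)

Ltac in_subfield sK := repeat first [assumption | exact: subfield0 sK
  | exact: subfield1 sK | exact: subfield_nat sK _
  | apply: (subfieldD sK) | apply: (subfieldB sK) | apply: (subfieldN sK)
  | apply: (subfield_div sK) | apply: (subfieldM sK) | apply: (subfieldX sK)].

(** A common equation for lines ([a = 0]) and circles ([a = 1]). *)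
Definition cycle_eq (R : realType) (a b c d : R) : set (R * R) :=
  [set x | a * (x.1 ^+ 2 + x.2 ^+ 2) + b * x.1 + c * x.2 + d = 0].

Lemma line_cycle_eq (R : realType) (p q : R * R) : p <> q ->
  line p q = cycle_eq 0 (q.2 - p.2) (p.1 - q.1) (q.1 * p.2 - p.1 * q.2)
  /\ (q.2 - p.2) ^+ 2 + (p.1 - q.1) ^+ 2 != 0.
Proof.
case: p q => [p1 p2] [q1 q2] pq /=.
have N0 : (q2 - p2) ^+ 2 + (p1 - q1) ^+ 2 != 0.
  apply: contra_notN pq; rewrite paddr_eq0 ?sqr_ge0// !sqrf_eq0 !subr_eq0.
  by move=> /andP[/eqP -> /eqP ->].
split=> //; apply/seteqP; split=> -[x y]; rewrite /line /cycle_eq /=.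
  by move=> [t [-> ->]]; ring.
move=> h.
(* The parameter is the coefficient of the orthogonal projection of [x - p] onto [q - p]. *)
exists (((x - p1) * (q1 - p1) + (y - p2) * (q2 - p2)) / ((q2 - p2) ^+ 2 + (p1 - q1) ^+ 2)).
congr pair; apply: (mulIf N0); rewrite mulrDl mulrAC divfK//; apply/eqP; rewrite -subr_eq0; apply/eqP.
  transitivity ((q2 - p2) * (0 * (x ^+ 2 + y ^+ 2) + (q2 - p2) * x + (p1 - q1) * y +
    (q1 * p2 - p1 * q2))); first by ring.
  by rewrite h mulr0.
transitivity ((p1 - q1) * (0 * (x ^+ 2 + y ^+ 2) + (q2 - p2) * x + (p1 - q1) * y +
    (q1 * p2 - p1 * q2))); first by ring.
by rewrite h mulr0.
Qed.

Lemma circle_cycle_eq (R : realType) (c p : R * R) :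
  circle c p = cycle_eq 1 (- (2 * c.1)) (- (2 * c.2))
    (2 * c.1 * p.1 + 2 * c.2 * p.2 - p.1 ^+ 2 - p.2 ^+ 2).
Proof.
apply/seteqP; split=> -[x y]; rewrite /circle /cycle_eq /= => h.
  by move/eqP: h; rewrite -subr_eq0 => /eqP h; rewrite -[RHS]h; ring.
by apply/eqP; rewrite -subr_eq0; apply/eqP; rewrite -[RHS]h; ring.
Qed.

Section SqrtClosed.
Variables (R : realType) (K : set R).
Hypotheses (sK : subfield K) (sqrtK : forall s, K (s ^+ 2) -> K s).

(** Completing the square: the square of [2 * a * x + b] is the discriminant, an element of [K]. *)
Lemma sqrt_closed_root (a b c x : R) : K a -> K b -> K c -> a != 0 ->
  a * x ^+ 2 + b * x + c = 0 -> K x.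
Proof.
move=> Ka Kb Kc a0 h.
have Kd : K (2 * a * x + b).
  apply: sqrtK.
  have -> : (2 * a * x + b) ^+ 2 = b ^+ 2 - 2 * 2 * a * c
      + 2 * 2 * a * (a * x ^+ 2 + b * x + c) by ring.
  rewrite h mulr0 addr0; in_subfield sK.
have -> : x = (2 * a * x + b - b) / (2 * a) by field.
in_subfield sK.
Qed.

(** Substituting [x] from the line equation into the circle equation and multiplying by [b ^+ 2]
    gives a quadratic equation for [y]. Its leading coefficient [b ^+ 2 + c ^+ 2] is positive. *)
Lemma sqrt_closed_meet_line_circle_aux (b c d b' c' d' x y : R) :
  K b -> K c -> K d -> K b' -> K c' -> K d' -> b != 0 ->
  b * x + c * y + d = 0 -> x ^+ 2 + y ^+ 2 + b' * x + c' * y + d' = 0 ->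
  K x /\ K y.
Proof.
move=> Kb Kc Kd Kb' Kc' Kd' b0 h h'.
have xE : x = - ((c * y + d) / b).
  by apply: (mulfI b0); rewrite mulrN mulrCA divff// mulr1; lra.
have Ky : K y.
  apply: (@sqrt_closed_root (b ^+ 2 + c ^+ 2)
    (2 * c * d - b * c * b' + b ^+ 2 * c') (d ^+ 2 - b * d * b' + b ^+ 2 * d')).
  - in_subfield sK.
  - in_subfield sK.
  - in_subfield sK.
  - by rewrite paddr_eq0 ?sqr_ge0// sqrf_eq0 (negbTE b0).
  - transitivity (b ^+ 2 * (x ^+ 2 + y ^+ 2 + b' * x + c' * y + d')); last by rewrite h' mulr0.
    by rewrite xE; field.
split=> //; rewrite xE; in_subfield sK.
Qed.

Lemma sqrt_closed_meet_line_circle (b c d b' c' d' x y : R) :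
  K b -> K c -> K d -> K b' -> K c' -> K d' -> b ^+ 2 + c ^+ 2 != 0 ->
  b * x + c * y + d = 0 -> x ^+ 2 + y ^+ 2 + b' * x + c' * y + d' = 0 ->
  K x /\ K y.
Proof.
move=> Kb Kc Kd Kb' Kc' Kd' bc0 h h'.
have [b0|b0] := eqVneq b 0; last exact: (@sqrt_closed_meet_line_circle_aux b c d b' c' d').
have c0 : c != 0 by apply: contraNneq bc0 => ->; rewrite b0 expr0n addr0.
(* The remaining case follows by exchanging the coordinates. *)
apply/and_comm; apply: (@sqrt_closed_meet_line_circle_aux c b d c' b' d') => //; lra.
Qed.

(** Cramer's rule. *)
Lemma subfield_meet_lines (b c d b' c' d' x y : R) :
  K b -> K c -> K d -> K b' -> K c' -> K d' -> b * c' - b' * c != 0 ->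
  b * x + c * y + d = 0 -> b' * x + c' * y + d' = 0 -> K x /\ K y.
Proof.
move=> Kb Kc Kd Kb' Kc' Kd' D0 h h'.
have -> : x = (c * d' - c' * d) / (b * c' - b' * c).
  apply: (mulIf D0); rewrite divfK//; apply/eqP; rewrite -subr_eq0; apply/eqP.
  transitivity (c' * (b * x + c * y + d) - c * (b' * x + c' * y + d')); first by ring.
  by rewrite h h' !mulr0 subr0.
have -> : y = (b' * d - b * d') / (b * c' - b' * c).
  apply: (mulIf D0); rewrite divfK//; apply/eqP; rewrite -subr_eq0; apply/eqP.
  transitivity (b * (b' * x + c' * y + d') - b' * (b * x + c * y + d)); first by ring.
  by rewrite h h' !mulr0 subr0.
by split; in_subfield sK.
Qed.

Lemma parallel_lines_sub (b c d b' c' d' : R) (p : R * R) :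
  b ^+ 2 + c ^+ 2 != 0 -> b * c' - b' * c = 0 ->
  cycle_eq 0 b c d p -> cycle_eq 0 b' c' d' p ->
  cycle_eq 0 b c d `<=` cycle_eq 0 b' c' d'.
Proof.
case: p => [u v] N0 D0; rewrite /cycle_eq /= => hp hp' [x y] /= hx.
apply: (mulfI N0); rewrite mulr0.
(* The normal vector [(b', c')] is expanded in the orthogonal basis [(b, c)], [(-c, b)]. *)
transitivity ((b ^+ 2 + c ^+ 2) * (0 * (u ^+ 2 + v ^+ 2) + b' * u + c' * v + d')
  + (b * b' + c * c') * ((0 * (x ^+ 2 + y ^+ 2) + b * x + c * y + d)
     - (0 * (u ^+ 2 + v ^+ 2) + b * u + c * v + d))
  + (b * c' - b' * c) * (b * (y - v) - c * (x - u))); first by ring.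
by rewrite hp hp' hx D0 subrr !mulr0 mul0r !addr0.
Qed.

(** With leading coefficient normalised to 0 or 1, subtracting two circle equations cancels the
    quadratic terms. *)
Definition cycle_over (X : set (R * R)) : Prop := exists a b c d,
  [/\ K a, K b, K c & K d] /\ X = cycle_eq a b c d
  /\ (a = 1 \/ a = 0 /\ b ^+ 2 + c ^+ 2 != 0).

Lemma sqrt_closed_meet (X Y : set (R * R)) (p : R * R) :
  cycle_over X -> cycle_over Y -> X <> Y -> X p -> Y p -> K p.1 /\ K p.2.
Proof.
move=> [a [b [c [d [[Ka Kb Kc Kd] [-> +]]]]]].
move=> + [a' [b' [c' [d' [[Ka' Kb' Kc' Kd'] [-> +]]]]]].
case=> [->|[-> N]] [->|[-> N']].
(* Two circles: the difference of the equations is their radical axis, unless they are concentric;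
   concentric circles with a common point are equal. *)
- have [D0|D0] := eqVneq ((b - b') ^+ 2 + (c - c') ^+ 2) 0.
    move=> XY Xp Yp; exfalso; apply: XY.
    move: D0 => /eqP; rewrite paddr_eq0 ?sqr_ge0// !sqrf_eq0 !subr_eq0.
    move=> /andP[/eqP bb /eqP cc]; congr cycle_eq => //.
    move: Xp Yp; rewrite /cycle_eq /= bb cc => Xp Yp; lra.
  rewrite /cycle_eq /= => _ h h'.
  apply: (@sqrt_closed_meet_line_circle (b - b') (c - c') (d - d') b c d _ _ _ _ _ _ _ _ D0);
    in_subfield sK; lra.
- rewrite /cycle_eq /= => _ h h'.
  by apply: (@sqrt_closed_meet_line_circle b' c' d' b c d) => //; lra.
- rewrite /cycle_eq /= => _ h h'.
  by apply: (@sqrt_closed_meet_line_circle b c d b' c' d') => //; lra.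
- move=> XY h h'.
  (* Parallel lines with a common point are equal. *)
  have [D0|D0] := eqVneq (b * c' - b' * c) 0.
    exfalso; apply: XY; apply/seteqP.
    split; [apply: parallel_lines_sub N D0 h h' | apply: parallel_lines_sub N' _ h' h].
    by rewrite -[LHS]opprK -[RHS]oppr0 -D0; ring.
  move: h h'; rewrite /cycle_eq /= => h h'.
  by apply: (@subfield_meet_lines b c d b' c' d' _ _ _ _ _ _ _ _ D0) => //; lra.
Qed.

(* Mutual induction carries one invariant for points and one for drawn curves: coordinates in [K],
   respectively an equation over [K]. *)
Scheme constructible_drawn_ind := Induction for constructible Sort Prop
  with drawn_constructible_ind := Induction for drawn Sort Prop.

Lemma constructible_sqrt_closed (S : set (R * R)) :
  (forall p, S p -> K p.1 /\ K p.2) ->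
  forall p, constructible S p -> K p.1 /\ K p.2.
Proof.
move=> SK.
apply: (@constructible_drawn_ind R S (fun p _ => K p.1 /\ K p.2)
  (fun X _ => cycle_over X)).
- by move=> p /SK.
- move=> X Y p _ hX _ hY; exact: sqrt_closed_meet.
- move=> p q _ [Kp1 Kp2] _ [Kq1 Kq2] pq.
  have [-> N] := line_cycle_eq pq.
  do 4!eexists; split; [split|split; [reflexivity|by right]]; in_subfield sK.
- move=> c p _ [Kc1 Kc2] _ [Kp1 Kp2] _; rewrite circle_cycle_eq.
  do 4!eexists; split; [split|split; [reflexivity|by left]]; in_subfield sK.
Qed.

End SqrtClosed.

(** * Gaussian rationals: (3 + 4i)/5 has no n-th root *)

Local Open Scope complex_scope.

(** The second clause is multiplicativity of the norm. For the third, z = a + bi satisfies z^2 = 2az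
    - (a^2 + b^2), so z^2 is congruent to 2az modulo 5 and z^(n+1) to (2a)^n z. *)
Lemma gaussian_expS (R : rcfType) (a b : int) (n : nat) : exists A B : int,
  [/\ (a%:~R +i* b%:~R : R[i]) ^+ n.+1 = A%:~R +i* B%:~R,
      A ^+ 2 + B ^+ 2 = (a ^+ 2 + b ^+ 2) ^+ n.+1
    & (5 %| a ^+ 2 + b ^+ 2)%Z ->
      (5 %| A - (2 * a) ^+ n * a)%Z /\ (5 %| B - (2 * a) ^+ n * b)%Z].
Proof.
elim: n => [|n [A [B [h1 h2 h3]]]].
  by exists a, b; split=> //; rewrite !expr0 !mul1r !subrr.
exists (a * A - b * B), (a * B + b * A); split.
- rewrite exprS h1.
  apply/eqP; rewrite eq_complex /=.
  by rewrite rmorphB rmorphD /= !rmorphM !eqxx.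
- by rewrite [RHS]exprS -h2; ring.
move=> h5; have [hA hB] := h3 h5; split.
- have -> : a * A - b * B - (2 * a) ^+ n.+1 * a =
    a * (A - (2 * a) ^+ n * a) - b * (B - (2 * a) ^+ n * b)
    - (2 * a) ^+ n * (a ^+ 2 + b ^+ 2) by rewrite exprS; ring.
  by rewrite !rpredB// dvdz_mull.
- have -> : a * B + b * A - (2 * a) ^+ n.+1 * b =
    a * (B - (2 * a) ^+ n * b) + b * (A - (2 * a) ^+ n * a) by rewrite exprS; ring.
  by rewrite rpredD// dvdz_mull.
Qed.

Lemma prime_dvdz_exp (p : nat) (x : int) (n : nat) : prime p ->
  (p %| x ^+ n)%Z -> (p %| x)%Z.
Proof. by move=> pp; rewrite !dvdzE abszX => /=; rewrite Euclid_dvdX// => /andP[]. Qed.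

Lemma prime_dvdz_mul (p : nat) (x y : int) : prime p ->
  (p %| x * y)%Z = (p %| x)%Z || (p %| y)%Z.
Proof. by move=> pp; rewrite !dvdzE abszM Euclid_dvdM. Qed.

(** Descent on the absolute value of [m]: a solution has [m], [a] and [b] all divisible by 5, and
    dividing them by 5 gives a smaller solution. *)
Lemma gaussian_no_root (R : rcfType) (n : nat) (a b m : int) : m != 0 ->
  5 * (a%:~R +i* b%:~R : R[i]) ^+ n.+2 <> m%:~R ^+ n.+2 * (3 +i* 4).
Proof.
have [N] := ubnP `|m|%N; elim: N => // N IH in a b m *; rewrite ltnS => mN m0 E.
have [A [B [h1 h2 h3]]] := gaussian_expS R a b n.+1.
have p5 : prime 5 by [].
move: (E); rewrite h1.
have -> : (5 : R[i]) = 5 +i* 0 by rewrite -[5 in LHS](rmorph_nat (real_complex R)).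
have -> : (m%:~R : R[i]) ^+ n.+2 = (m ^+ n.+2)%:~R +i* 0.
  by rewrite -rmorphXn -[LHS](rmorph_int (real_complex R)).
move=> /eqP; rewrite eq_complex /= !mul0r !subr0 !addr0.
have e5 : (5 : R) = (5 : int)%:~R by [].
have e3 : (3 : R) = (3 : int)%:~R by [].
have e4 : (4 : R) = (4 : int)%:~R by [].
rewrite e5 e3 e4 -!rmorphM !eqr_int => /andP[/eqP EA /eqP EB].
have m5 : (5 %| m)%Z.
  apply: (@prime_dvdz_exp 5 m n.+2) => //.
  have : (5 %| m ^+ n.+2 * 3)%Z by rewrite -EA dvdz_mulr.
  by rewrite prime_dvdz_mul// orbF.
have /dvdzP[m' mE] := m5.
have ab5 : (5 %| a ^+ 2 + b ^+ 2)%Z.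
  apply: (@prime_dvdz_exp 5 _ n.+2) => //; rewrite -h2.
  (* Comparison of norms, with 3^2 + 4^2 = 5^2. *)
  have -> : A ^+ 2 + B ^+ 2 = (m ^+ n.+2) ^+ 2.
    apply: (@mulfI _ (5 ^+ 2)) => //.
    rewrite mulrDr -!exprMn EA EB; ring.
  by rewrite -exprM dvdz_exp.
have {h3} [hA _] := h3 ab5.
have A5 : (5 %| A)%Z.
  (* The exponent is at least 2, so 25 divides [m ^+ n.+2], hence [5 * A]. *)
  suff /dvdzP[q hq] : (25 %| 5 * A)%Z.
    apply/dvdzP; exists q; apply: (@mulfI _ 5) => //; rewrite hq; ring.
  rewrite EA mE !exprS; apply/dvdzP; exists (m' * (m' * ((m' * 5) ^+ n)) * 3).
  ring.
have a5 : (5 %| a)%Z.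
  have : (5 %| (2 * a) ^+ n.+1 * a)%Z.
    by rewrite -[X in (_ %| X)%Z](subKr A) rpredB.
  rewrite prime_dvdz_mul// => /orP[|//] /(prime_dvdz_exp p5).
  by rewrite prime_dvdz_mul.
have b5 : (5 %| b)%Z.
  apply: (@prime_dvdz_exp 5 _ 2) => //.
  by rewrite -(addKr (a ^+ 2) (b ^+ 2)) rpredD// rpredN dvdz_exp.
have /dvdzP[a' aE] := a5; have /dvdzP[b' bE] := b5.
have m'0 : m' != 0 by apply: contraNneq m0 => h; rewrite mE h mul0r.
apply: (IH a' b' m') => //.
  apply: leq_trans mN; rewrite mE abszM /=.
  by rewrite ltn_Pmulr// absz_gt0.
have scale (u v : R[i]) : u ^+ n.+2 * v ^+ n.+2 = (u * v) ^+ n.+2 by rewrite exprMn.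
apply: (@mulfI R[i] (5 ^+ n.+2)); first by rewrite expf_neq0// pnatr_eq0.
rewrite [LHS]mulrCA [RHS]mulrA !scale.
have -> : 5 * (a'%:~R +i* b'%:~R) = a%:~R +i* b%:~R :> R[i].
  have -> : (5 : R[i]) = 5 +i* 0 by rewrite -[5 in LHS](rmorph_nat (real_complex R)).
  apply/eqP; rewrite eq_complex /= !mul0r subr0 addr0 aE bE !rmorphM /=.
  by rewrite ![_ * 5%:~R]mulrC !eqxx.
by rewrite E mE rmorphM /= [5 * _]mulrC.
Qed.

Definition gaussian_rational (R : rcfType) : set R[i] :=
  [set z | exists x y : rat, z = ratr x +i* ratr y].

Lemma gaussian_rational_subfield (R : rcfType) : subfield (@gaussian_rational R).
Proof.
split.
- by exists 1, 0; rewrite rmorph0 rmorph1.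
- move=> _ _ [x [y ->]] [x' [y' ->]]; exists (x - x'), (y - y').
  by apply/eqP; rewrite eq_complex /= !rmorphB !eqxx.
- move=> _ _ [x [y ->]] [x' [y' ->]].
  (* These expressions mirror the product and inverse of [R[i]], which also covers a zero
     divisor. *)
  exists (x * (x' / (x' ^+ 2 + y' ^+ 2)) - y * - (y' / (x' ^+ 2 + y' ^+ 2))),
    (x * - (y' / (x' ^+ 2 + y' ^+ 2)) + y * (x' / (x' ^+ 2 + y' ^+ 2))).
  apply/eqP; rewrite eq_complex /=.
  by rewrite !(rmorphB, rmorphD, rmorphM, rmorphN, fmorphV, rmorphXn) /= !eqxx.
Qed.

Lemma gaussian_rational_no_root (R : rcfType) (n : nat) (z : R[i]) : (1 < n)%N ->
  gaussian_rational z -> z ^+ n <> (3 / 5) +i* (4 / 5).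
Proof.
case: n => [|[|n]]// _ [x [y ->]] E.
have m0 : denq x * denq y != 0 by rewrite mulf_neq0// denq_neq0.
(* Put [x] and [y] over the common denominator [denq x * denq y]. *)
apply: (@gaussian_no_root R n (numq x * denq y) (numq y * denq x) (denq x * denq y) m0).
have -> : (numq x * denq y)%:~R +i* (numq y * denq x)%:~R =
    (denq x * denq y)%:~R * (ratr x +i* ratr y) :> R[i].
  rewrite -(rmorph_int (real_complex R)).
  have dx : (denq x)%:~R != 0 :> R by rewrite intr_eq0 denq_neq0.
  have dy : (denq y)%:~R != 0 :> R by rewrite intr_eq0 denq_neq0.
  apply/eqP; rewrite eq_complex /= !mul0r subr0 addr0 /ratr !rmorphM /=.
  by apply/andP; split; apply/eqP; field.
rewrite exprMn E mulrCA; congr (_ * _).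
have -> : (5 : R[i]) = 5 +i* 0 by rewrite -[5 in LHS](rmorph_nat (real_complex R)).
by apply/eqP; rewrite eq_complex /= !mul0r subr0 addr0 !mulrA ![5 * _]mulrC !mulfK ?eqxx ?pnatr_eq0.
Qed.

(** * Angles and the dense family *)

Lemma complex_angle_exp (R : realType) (a : R) (n : nat) :
  (cos a +i* sin a) ^+ n = cos (n%:R * a) +i* sin (n%:R * a).
Proof.
elim: n => [|n IH]; first by rewrite expr0 mul0r cos0 sin0.
rewrite exprS IH -natr1 mulrDl mul1r addrC cosD sinD.
by apply/eqP; rewrite eq_complex /= addrC eqxx /= addrC; apply/eqP; ring.
Qed.

Lemma complex_angleD (R : realType) (a b : R) :
  (cos a +i* sin a) * (cos b +i* sin b) = cos (a + b) +i* sin (a + b) :> R[i].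
Proof.
rewrite cosD sinD; apply/eqP; rewrite eq_complex /= eqxx /=; apply/eqP; ring.
Qed.

(** With [sin_2atan], the rational parametrisation of the circle: rational [t] gives rational
    coordinates. *)
Lemma cos_2atan (R : realType) (t : R) : cos (2 * atan t) = (1 - t ^+ 2) / (1 + t ^+ 2).
Proof.
have t0 : 0 < 1 + t ^+ 2 by rewrite ltr_pwDl// sqr_ge0.
rewrite mulr_natl cos_mulr2n cos_atan exprVn sqr_sqrtr ?ltW//.
by field; rewrite gt_eqF.
Qed.

Lemma sin_2atan (R : realType) (t : R) : sin (2 * atan t) = 2 * t / (1 + t ^+ 2).
Proof.
have t0 : 0 < 1 + t ^+ 2 by rewrite ltr_pwDl// sqr_ge0.
have c0 : cos (atan t) != 0.
  by apply/lt0r_neq0/cos_gt0_pihalf; rewrite atan_gtNpi2 atan_ltpi2.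
rewrite mulr_natl sin_mulr2n.
have -> : sin (atan t) = t * cos (atan t) by apply/(canRL (divfK c0)); exact: atanK.
rewrite mulrCA -expr2 cos_atan exprVn sqr_sqrtr ?ltW//.
by field; rewrite gt_eqF.
Qed.

Lemma unit_circle_angle (R : realType) (p : R * R) : unit_circle p ->
  exists2 a : R, - pi <= a <= pi & p = angle_point a.
Proof.
case: p => [x y]; rewrite /unit_circle /angle_point /= => h.
have x1 : -1 <= x <= 1.
  rewrite -ler_norml -(@ler_pXn2r _ 2)// ?nnegrE// expr1n real_normK ?num_real//.
  by rewrite -h lerDl sqr_ge0.
have yE : y ^+ 2 = 1 - x ^+ 2 by rewrite -h addrC addKr.
have [y0|y0] := leP 0 y.
- exists (acos x).
    by rewrite acos_lepi// andbT (le_trans _ (acos_ge0 x1))// oppr_le0 pi_ge0.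
  by rewrite acosK ?in_itv//= sin_acos// -yE sqrtr_sqr ger0_norm.
- exists (- acos x).
    by rewrite lerN2 acos_lepi//= (le_trans _ (pi_ge0 R))// oppr_le0 acos_ge0.
  by rewrite cosN sinN acosK ?in_itv//= sin_acos// -yE sqrtr_sqr ltr0_norm// opprK.
Qed.

(** An argument of (3 + 4i)/5 times the n-th power of exp(2i atan t), written as an angle continuous
    in [t]. *)
Definition twisted_angle (R : realType) (n : nat) (t : R) : R :=
  2 * (atan 2^-1 + n%:R * atan t).

(** Every point of the circle is the value at some real [t] of a continuous map, and rationals are
    dense near [t]. *)
Lemma twisted_angle_dense (R : realType) (n : nat) : (2 < n)%N ->
  @unit_circle R `<=` closure
    [set angle_point (twisted_angle n (ratr q : R)) | q in [set: rat]].
Proof.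
move=> n2 p /unit_circle_angle[a apibnd ->].
have n0 : 0 < n%:R :> R by rewrite ltr0n (ltn_trans _ n2).
pose b := (a / 2 - atan 2^-1) / n%:R.
(* The numerator of [b] lies above -pi and is at most pi/2, while n pi/2 is at least 3 pi/2. *)
have bpi : - (pi / 2) < b < pi / 2.
  have h1 := @atan_ltpi2 R 2^-1; have h2 : 0 <= atan (2^-1 : R).
    by rewrite -(atan0 R) le_atan// invr_ge0.
  have h3 : 3 * pi <= n%:R * pi :> R by rewrite ler_pM2r ?pi_gt0// ler_nat.
  have := pi_gt0 R; move: apibnd => /andP[h4 h5] h6.
  by rewrite ltr_pdivlMr// ltr_pdivrMr//; apply/andP; split; lra.
have -> : angle_point a = angle_point (twisted_angle n (tan b)).
  rewrite /twisted_angle tanK ?in_itv//; congr angle_point.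
  by rewrite /b; field; rewrite gt_eqF.
set g := fun t : R => angle_point (twisted_angle n t).
have gc : {for tan b, continuous g}.
  have tc : {for tan b, continuous (@twisted_angle R n)}.
    apply: cvgM; first exact: cvg_cst.
    apply: cvgD; first exact: cvg_cst.
    by apply: cvgM; [exact: cvg_cst | exact: continuous_atan].
  have cc : {for tan b, continuous (cos \o @twisted_angle R n)}.
    by apply: continuous_comp; [exact: tc | exact: continuous_cos].
  have sc : {for tan b, continuous (sin \o @twisted_angle R n)}.
    by apply: continuous_comp; [exact: tc | exact: continuous_sin].
  exact: (cvg_pair cc sc).
move=> U /gc gU; have : nbhs (tan b) (g @^-1` U) := gU.
rewrite nbhsE => -[V [Vo Vb] VU].
have [t [Vt [q _ qt]]] := @dense_rat R V (ex_intro _ _ Vb) Vo.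
have Ut := VU _ Vt; rewrite -qt in Ut.
by exists (g (ratr q)); split=> //; exists q.
Qed.

Lemma angle_gaussian_rational (R : realType) (q : rat) :
  gaussian_rational (cos (2 * atan (ratr q)) +i* sin (2 * atan (ratr q)) : R[i]).
Proof.
exists ((1 - q ^+ 2) / (1 + q ^+ 2)), (2 * q / (1 + q ^+ 2)).
rewrite cos_2atan sin_2atan.
by rewrite !(rmorphB, rmorphD, rmorphM, fmorphV, rmorphXn, rmorph1, rmorph_nat).
Qed.

(* The angle [2 * atan 2^-1] is that of (3 + 4i)/5. *)
Lemma twisted_angle_complex (R : realType) (n : nat) (q : rat) :
  let z : R := twisted_angle n (ratr q) in
  cos z +i* sin z = (3 / 5 +i* (4 / 5)) *
    (cos (2 * atan (ratr q)) +i* sin (2 * atan (ratr q))) ^+ n :> R[i].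
Proof.
move=> z; rewrite complex_angle_exp.
have -> : 3 / 5 +i* (4 / 5) = cos (2 * atan 2^-1) +i* sin (2 * atan 2^-1) :> R[i].
  by rewrite cos_2atan sin_2atan; apply/eqP; rewrite eq_complex /=; apply/andP; split; apply/eqP; field.
have -> : z = 2 * atan 2^-1 + n%:R * (2 * atan (ratr q)).
  by rewrite /z /twisted_angle; ring.
by rewrite complex_angleD.
Qed.

Lemma twisted_angle_gaussian_rational (R : realType) (n : nat) (q : rat) :
  let z : R := twisted_angle n (ratr q) in gaussian_rational (cos z +i* sin z).
Proof.
move=> z; rewrite twisted_angle_complex; apply: (subfieldM (gaussian_rational_subfield R)).
  by exists (3 / 5), (4 / 5); rewrite !(rmorphM, fmorphV, rmorph_nat).
by apply: (subfieldX (gaussian_rational_subfield R)); exact: angle_gaussian_rational.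
Qed.

(** Dividing a root by the Gaussian rational exp(2i atan q) would leave an n-th root of (3 +
    4i)/5. *)
Lemma twisted_angle_no_root (R : realType) (n : nat) (q : rat) (w : R[i]) :
  let z : R := twisted_angle n (ratr q) in (1 < n)%N ->
  gaussian_rational w -> w ^+ n <> cos z +i* sin z.
Proof.
move=> z n1 Qw; rewrite twisted_angle_complex => E.
set u := cos _ +i* sin _ in E.
have u0 : u != 0.
  rewrite eq_complex /= -norm_cos_eq1; apply/negP => /andP[/eqP -> ].
  by rewrite normr0 eq_sym oner_eq0.
apply: (@gaussian_rational_no_root R n (w / u)) => //.
  apply: (subfield_div (gaussian_rational_subfield R) Qw).
  exact: angle_gaussian_rational.
by rewrite exprMn exprVn E mulfK// expf_neq0.
Qed.

(** * Non-sectability and conclusion *)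

Lemma not_sectable_of_no_root (R : realType) (n : nat) (a : R) : odd n ->
  gaussian_rational (cos a +i* sin a) ->
  (forall w, gaussian_rational w -> w ^+ n <> cos a +i* sin a) ->
  ~ sectable n a.
Proof.
move=> nodd Qc noroot sect.
have [K [QK sK sqrtK Kn]] :=
  sqrt_closed_no_odd_root nodd (gaussian_rational_subfield R) Qc noroot.
(* Real coordinates are handled in the real part of [K], again closed under square roots; as [K]
   contains ['i], they recombine to a complex number in [K]. *)
pose KR : set R := [set x | K x%:C].
have sKR : subfield KR.
  split; rewrite /KR /= ?rmorph1; first exact: subfield1 sK.
  - by move=> x y Kx Ky; rewrite rmorphB; exact: (subfieldB sK Kx Ky).
  - by move=> x y Kx Ky; rewrite rmorphM fmorphV; exact: (subfield_div sK Kx Ky).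
have sqrtKR s : KR (s ^+ 2) -> KR s.
  by rewrite /KR /= rmorphXn; exact: sqrtK.
have QKR q : KR (ratr q).
  by apply: QK; exists q, 0; rewrite rmorph0.
have Ki : K 'i by apply: QK; exists 0, 1; rewrite rmorph0 rmorph1.
have n0 : n%:R != 0 :> R by rewrite pnatr_eq0; case: n nodd {sect noroot Kn}.
have [] := constructible_sqrt_closed sKR sqrtKR _ sect.
  move=> _ [[]|] ->/=.
  - by split; exact: subfield0.
  - by split; [exact: subfield1|exact: subfield0].
  - by case: Qc => x [y [-> ->]]; split; exact: QKR.
move=> /= Kcos Ksin.
apply: (Kn (cos (a / n%:R) +i* sin (a / n%:R))).
  rewrite [_ +i* _]complexE /=.
  by apply: (subfieldD sK Kcos); exact: (subfieldM sK Ki Ksin).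
by rewrite complex_angle_exp mulrC divfK.
Qed.

Theorem propositionA2 (R : realType) (n : nat) (hn : (1 < n)%N)
  (hodd : odd n) (hconstr : constructible_angle (2 * pi / n%:R : R)) :
  exists D : set (R * R),
    [/\ D `<=` @unit_circle R,
        countable D,
        @unit_circle R `<=` closure D
      & forall a : R, D (angle_point a) -> ~ sectable n a].
Proof.
exists [set angle_point (twisted_angle n (ratr q : R)) | q in [set: rat]]; split.
- by move=> _ [q _ <-]; exact: cos2Dsin2.
- exact: sub_countable (card_image_le _ _) (countableP _).
- by apply: twisted_angle_dense; case: n hn hodd {hconstr} => [|[|[|n]]].
(* Here [a] need only agree with a twisted angle in cosine and sine, and the criterion is stated
   through these alone. *)
move=> a [q _ [cE sE]]; apply: not_sectable_of_no_root => //.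
  by rewrite -cE -sE; exact: twisted_angle_gaussian_rational.
by move=> w Qw; rewrite -cE -sE; exact: twisted_angle_no_root.
Qed.
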